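(* Let $c<d$ be real numbers with $0\le c$ (Case I) or $d\le 0$ (Case II), and let $\Omega^*=[c,d]$. There exist thresholds $\alpha_0\ge \max(c^2,d^2)/2$, $\alpha_0>0$, and $a_0>0$, depending only on $c,d$, such that the following holds for every $\alpha\ge\alpha_0$ and every interval $\Omega=[a,b]$, $a<b$. Case I. Suppose $0\le c<d<a<b$, $a\ge a_0$, and $K^{\rm I}_\varepsilon>1$ for every $\varepsilon>0$. Then there exists $f^-\in\mathcal{A}_\alpha$ which is a global maximizer of $\mathbb{E}_u(Y):=\int_{\Omega^*}y\,u(y)\,dy$ over $u\in\mathcal{A}_\alpha$. Case II. Suppose $a<b<c<d\le 0$, $b\le -a_0$, and $K^{\rm II}_\varepsilon>1$ for every $\varepsilon>0$. Then there exists $f^-\in\mathcal{A}_\alpha$ which is a global minimizer of $\mathbb{E}_u(Y)=\int_{\Omega^*}y\,u(y)\,dy$ over $u\in\mathcal{A}_\alpha$.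
   Context: $\mathcal{A}_\alpha$ is the set of distribution densities $u\in W_0^{1,\infty}(\Omega^* )\cap C(\overline{\Omega^*})$ with $u\ge0$ a.e. in $\Omega^*$, $\|u\|_{L^1(\Omega^* )}=1$ and $\|u_y\|_{L^\infty(\Omega^* )}\le\alpha$, where $u_y$ is the weak derivative. For $\varepsilon>0$, $E_\varepsilon(\gamma):=\gamma^2\ln(e^{\alpha^2}\gamma^{2\varepsilon})$ for $\gamma\in[e^{-\alpha^2/(2\varepsilon)},1]$; it is strictly increasing onto $[0,\alpha^2]$, and $E_\varepsilon^{-1}:[0,\alpha^2]\to[e^{-\alpha^2/(2\varepsilon)},1]$ is its inverse. Write $h_\varepsilon(\theta):=\theta/E_\varepsilon^{-1}(\theta^2)$ for $|\theta|\le\alpha$. Case I ($0\le c<d$): let $r_{\rm I}\in(c^2/2,d^2/2)$ be the unique number with $\int_c^d h_\varepsilon(r_{\rm I}-x^2/2)\,dx=0$, and set $K^{\rm I}_\varepsilon:=\int_c^d\int_d^y h_\varepsilon(r_{\rm I}-x^2/2)\,dx\,dy$. Case II ($c<d\le0$): let $r_{\rm II}\in(d^2/2,c^2/2)$ be the unique number with $\int_c^d h_\varepsilon(x^2/2-r_{\rm II})\,dx=0$, and set $K^{\rm II}_\varepsilon:=\int_c^d\int_c^y h_\varepsilon(x^2/2-r_{\rm II})\,dx\,dy$. *)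

(* Defs.v *)
From HB Require Import structures.
From mathcomp Require Import all_boot all_order all_algebra.
From mathcomp Require Import all_classical all_reals all_analysis.

Set Implicit Arguments.
Unset Strict Implicit.
Unset Printing Implicit Defensive.

Import Order.TTheory GRing.Theory Num.Theory.
Import numFieldNormedType.Exports.

Local Open Scope classical_set_scope.
Local Open Scope ring_scope.

(* A function on [c, d] is represented by a total function R -> R whose values
   outside [c, d] are never used. *)

Definition test_function (R : realType) (c d : R) (phi : R -> R) : Prop :=
  (forall (n : nat) (x : R), derivable (derive1n n phi) x 1) /\
  (let supp := closure [set x | phi x != 0] in
   compact supp /\ supp `<=` `]c, d[).

Definition Linfty (R : realType) (D : set R) (f : R -> R) : Prop :=
  f \_ D \in Lfun (@lebesgue_measure R) +oo%E.

Definition Linfty_norm (R : realType) (D : set R) (f : R -> R) : \bar R :=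
  ('N[@lebesgue_measure R]_(+oo) [EFin \o (f \_ D)])%E.

Definition L1_norm (R : realType) (D : set R) (f : R -> R) : \bar R :=
  ('N[@lebesgue_measure R]_1 [EFin \o (f \_ D)])%E.

Definition weak_derivative (R : realType) (c d : R) (u v : R -> R) : Prop :=
  locally_integrable `]c, d[ v /\
  forall phi, test_function c d phi ->
    \int[@lebesgue_measure R]_(x in `[c, d]) (u x * derive1 phi x) =
    - \int[@lebesgue_measure R]_(x in `[c, d]) (v x * phi x).

Definition W1infty (R : realType) (c d : R) (u : R -> R) : Prop :=
  Linfty `[c, d] u /\
  exists2 v, weak_derivative c d u v & Linfty `[c, d] v.

(* The W_0^{1,oo} functions that are continuous on [c, d]: the subscript 0 is
   vanishing trace, which for a continuous function is vanishing at the
   endpoints. It is not the W^{1,oo}-norm closure of the test functions, which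
   contains only C^1 functions. *)
Definition W01infty_C (R : realType) (c d : R) (u : R -> R) : Prop :=
  [/\ W1infty c d u, {within `[c, d], continuous u}, u c = 0 & u d = 0].

Definition densities (R : realType) (c d alpha : R) : set (R -> R) :=
  [set u | [/\ W01infty_C c d u,
      {ae @lebesgue_measure R, forall x : R, x \in `[c, d] -> 0 <= u x},
      L1_norm `[c, d] u = 1%E &
      exists2 uy, weak_derivative c d u uy &
        (Linfty_norm `[c, d] uy <= alpha%:E)%E ] ].

Definition expectation_density (R : realType) (c d : R) (u : R -> R) : R :=
  \int[@lebesgue_measure R]_(y in `[c, d]) (y * u y).

Definition E_eps (R : realType) (alpha eps gamma : R) : R :=
  gamma ^+ 2 * ln (expR (alpha ^+ 2) * gamma `^ (2 * eps)).

Definition E_eps_inv (R : realType) (alpha eps : R) : R -> R :=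
  'pinv_(fun=> 0) `[expR (- alpha ^+ 2 / (2 * eps)), 1] (E_eps alpha eps).

Definition h_eps (R : realType) (alpha eps theta : R) : R :=
  theta / E_eps_inv alpha eps (theta ^+ 2).

Definition oriented_integral (R : realType) (a b : R) (f : R -> R) : R :=
  if a <= b then \int[@lebesgue_measure R]_(x in `[a, b]) f x
  else - \int[@lebesgue_measure R]_(x in `[b, a]) f x.

(* [xget 0 A] is the element of A, which is unique in the next two definitions
   when 0 <= c < d (resp. c < d <= 0), 0 < eps and
   max(c^2, d^2) / 2 <= alpha. *)
Definition r_I (R : realType) (c d alpha eps : R) : R :=
  xget 0 [set r | r \in (`]c ^+ 2 / 2, d ^+ 2 / 2[ : interval R) /\
    oriented_integral c d (fun x => h_eps alpha eps (r - x ^+ 2 / 2)) = 0].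

Definition r_II (R : realType) (c d alpha eps : R) : R :=
  xget 0 [set r | r \in (`]d ^+ 2 / 2, c ^+ 2 / 2[ : interval R) /\
    oriented_integral c d (fun x => h_eps alpha eps (x ^+ 2 / 2 - r)) = 0].

Definition K_I (R : realType) (c d alpha eps : R) : R :=
  oriented_integral c d (fun y => oriented_integral d y
    (fun x => h_eps alpha eps (r_I c d alpha eps - x ^+ 2 / 2))).

Definition K_II (R : realType) (c d alpha eps : R) : R :=
  oriented_integral c d (fun y => oriented_integral c y
    (fun x => h_eps alpha eps (x ^+ 2 / 2 - r_II c d alpha eps))).

Definition global_maximizer (R : realType) (T : Type) (A : set T) (F : T -> R)
  (f : T) : Prop := A f /\ forall u, A u -> F u <= F f.

Definition global_minimizer (R : realType) (T : Type) (A : set T) (F : T -> R)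
  (f : T) : Prop := A f /\ forall u, A u -> F f <= F u.

(* Main.v *)
(* An admissible density is alpha-Lipschitz, nonnegative, of mass 1 and vanishes
   at c and d.  Once alpha >= 4 / (d - c)^2, the tent of slope alpha and mass 1
   whose support ends at d is admissible.  For any other admissible u, tent - u is
   at first nonpositive and then nonnegative, say with the change of sign at z;
   since the two masses agree, the difference of the expectations is the integral
   of (y - z) (tent y - u y) >= 0.  Hence the tent maximizes the expectation, and
   symmetrically the tent supported next to c minimizes it.

   The Lipschitz bound is obtained by testing the weak derivative against a smooth
   plateau, the difference of two translates of a smooth step: the derivative of the
   step is an approximate identity, so the test yields u x - u y in the limit. *)
Require Import Defs.
From HB Require Import structures.
From mathcomp Require Import all_boot all_order all_algebra.
From mathcomp Require Import all_classical all_reals all_analysis.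
From mathcomp Require Import measurable_realfun ess_sup_inf ring lra.

Set Implicit Arguments.
Unset Strict Implicit.
Unset Printing Implicit Defensive.

Import Order.TTheory GRing.Theory Num.Theory.
Import numFieldNormedType.Exports.
Local Open Scope classical_set_scope.
Local Open Scope ring_scope.

(** * Smooth step functions *)

(** The difference quotient at distance [h] is at most [C * |h|] in absolute value. This settles
    differentiability at 0, where [flat] changes its formula. *)
Lemma is_derive_sqr_bound {R : realType} (f : R -> R) (C x : R) :
  (forall y, `|f y - f x| <= C * (y - x) ^+ 2) -> is_derive x 1 f 0.
Proof.
move=> fC.
have C0 : 0 <= C.
  by have := fC (x + 1); rewrite addrAC subrr add0r expr1n mulr1; apply: le_trans.
have cf : (fun h : R => h^-1 *: (f (h *: 1 + x) - f x)) @ 0^' --> (0 : R).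
  apply/cvgrPdist_le => e e0; rewrite near_withinE.
  near=> h => h0.
  rewrite sub0r normrN normrM normfV.
  have -> : h *: (1 : R) = h by rewrite /GRing.scale /= mulr1.
  have := fC (h + x); rewrite addrK => /le_trans fh.
  rewrite ler_pdivrMl ?normr_gt0//; apply: fh.
  rewrite -(real_normK (num_real h)) expr2 mulrA [leRHS]mulrC ler_wpM2r//.
  rewrite -[leRHS]mul1r -[e in leRHS](@divfK _ (C + 1));
    last by rewrite gt_eqF// ltr_wpDl.
  rewrite mul1r [leRHS]mulrC; apply: ler_pM => //; first by rewrite lerDl.
  near: h.
  (* Dividing by [C + 1] keeps the radius meaningful when [C = 0]. *)
  apply/nbhs_normP; exists (e / (C + 1)).
    by rewrite /= divr_gt0// ltr_wpDl.
  by move=> z /=; rewrite sub0r normrN => /ltW.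
apply: DeriveDef; first by apply/cvg_ex; exists 0.
exact: cvg_lim.
Unshelve. all: by end_near. Qed.

(** The classical flat function [exp(-1/t)], extended by 0. The factor [t^-n] is carried along
    because differentiation raises it. *)
Definition flat {R : realType} (n : nat) (t : R) : R :=
  if 0 < t then t^-1 ^+ n * expR (- t^-1) else 0.

Lemma flat_ge0 {R : realType} n (t : R) : 0 <= flat n t.
Proof.
rewrite /flat; case: ifPn => // t0.
by rewrite mulr_ge0 ?expR_ge0// exprn_ge0// invr_ge0 ltW.
Qed.

(** For [s = 1/t > 0] the exponential series gives [s^(n+2) <= (n+2)! * exp s]; dividing by
    [s^2 * exp s] gives the bound. *)
Lemma flat_le_sqr {R : realType} n (t : R) :
  `|flat n t| <= n.+2`!%:R * t ^+ 2.
Proof.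
rewrite ger0_norm ?flat_ge0// /flat; case: ifPn => [t0|_]; last first.
  by rewrite mulr_ge0// sqr_ge0.
have /(expR_ge1Dxn n.+1) h : 0 <= t^-1 by rewrite invr_ge0 ltW.
have {}h : t^-1 ^+ n.+2 <= n.+2`!%:R * expR t^-1.
  rewrite -ler_pdivrMl ?ltr0n ?fact_gt0// mulrC.
  by apply: le_trans h; rewrite lerDr.
rewrite expRN ler_pdivrMr ?expR_gt0// mulrAC -ler_pdivrMr ?exprn_gt0//.
by rewrite -exprVn -exprD addn2.
Qed.

(** Away from 0 the function agrees locally with 0 or with the explicit formula; at 0 the quadratic
    bound forces derivative 0, which is also the value of the right-hand side there. *)
Lemma is_derive_flat {R : realType} n (t : R) :
  is_derive t 1 (flat n) (flat n.+2 t - n%:R * flat n.+1 t).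
Proof.
have [t0|t0|->] := ltgtP t 0.
- have -> : flat n.+2 t - n%:R * flat n.+1 t = 0.
    by rewrite /flat ltNge (ltW t0)/= mulr0 subr0.
  apply: (@near_eq_is_derive _ _ _ (cst 0)).
  near=> z; rewrite /flat ltNge ltW//.
  by near: z; exact: lt_nbhsl.
- have -> : flat n.+2 t - n%:R * flat n.+1 t =
    (t^-1 ^+ n.+2 - n%:R * t^-1 ^+ n.+1) * expR (- t^-1).
    by rewrite /flat t0 mulrBl mulrA.
  apply: (@near_eq_is_derive _ _ _ (fun s : R => s^-1 ^+ n * expR (- s^-1))).
    near=> z; rewrite /flat (_ : 0 < z)//.
    by near: z; exact: lt_nbhsr.
  have t0' : t != 0 by rewrite gt_eqF.
  have dV : is_derive t 1 (fun s : R => s^-1) (- t ^- 2).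
    by have := is_deriveV t0' (is_derive_id t 1); rewrite /GRing.scale/= mulr1.
  have dE : is_derive t 1 (fun s : R => expR (- s^-1)) (t ^- 2 * expR (- t^-1)).
    have dN : is_derive t 1 (fun s : R => - s^-1) (- - t ^- 2) by exact: is_deriveN.
    rewrite mulrC -[t ^- 2]opprK.
    exact: (is_derive1_comp (is_derive_expR _) dN).
  have dX : is_derive t 1 (fun s : R => s^-1 ^+ n)
      (n%:R * t^-1 ^+ n.-1 * (- t ^- 2)).
    have dn : is_derive t^-1 1 (@GRing.exp R ^~ n) (n%:R * t^-1 ^+ n.-1).
      apply: DeriveDef; first exact: exprn_derivable.
      by rewrite exp_derive /GRing.scale/= mulr1.
    exact: (is_derive1_comp dn dV).
  have := is_deriveM dX dE; rewrite /GRing.scale/=.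
  congr (is_derive _ _ _ _).
  (* The power rule yields the truncated exponent [n.-1], so [n = 0] is treated apart. *)
  rewrite -exprVn; case: n {dX} => [|n] /=; first by ring.
  by rewrite !exprS; ring.
- have -> : flat n.+2 0 - n%:R * flat n.+1 0 = 0 :> R.
    by rewrite /flat ltxx mulr0 subrr.
  apply: (@is_derive_sqr_bound _ _ n.+2`!%:R) => y.
  by rewrite {2}/flat ltxx !subr0; exact: flat_le_sqr.
Unshelve. all: by end_near. Qed.

(* A class of functions closed under differentiation, hence made of smooth
   functions. *)
Inductive flat_generated {R : realType} : (R -> R) -> Prop :=
| FlatGenFlat n : flat_generated (flat n)
| FlatGenCst k : flat_generated (fun=> k)
| FlatGenD f g : flat_generated f -> flat_generated g ->
    flat_generated (fun t => f t + g t)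
| FlatGenM f g : flat_generated f -> flat_generated g ->
    flat_generated (fun t => f t * g t)
| FlatGenV f : (forall t, f t != 0) -> flat_generated f ->
    flat_generated (fun t => (f t)^-1)
| FlatGenAff f a b : flat_generated f -> flat_generated (fun t => f (a * t + b)).

(** The derivative comes with its membership in the class, so that the statement can be iterated to
    all orders. *)
Lemma flat_generated_is_derive {R : realType} (f : R -> R) :
  flat_generated f ->
  exists2 f' : R -> R, flat_generated f' & forall t : R, is_derive t 1 f (f' t).
Proof.
elim => {f} [n|k|f g fS [f' f'S df] gS [g' g'S dg]|
  f g fS [f' f'S df] gS [g' g'S dg]|f f0 fS [f' f'S df]|f a b fS [f' f'S df]].
- exists (fun t => flat n.+2 t + (- n%:R) * flat n.+1 t).
    by apply: FlatGenD; [|apply: FlatGenM]; constructor.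
  by move=> t; rewrite mulNr; exact: is_derive_flat.
- by exists (fun=> 0); [constructor|move=> t; exact: is_derive_cst].
- exists (fun t => f' t + g' t); first exact: FlatGenD.
  by move=> t; exact: is_deriveD.
- exists (fun t => f t * g' t + g t * f' t).
    by apply: FlatGenD; exact: FlatGenM.
  by move=> t; exact: (is_deriveM (df t) (dg t)).
- exists (fun t => -1 * ((f t)^-1 * (f t)^-1) * f' t).
    do 2?apply: FlatGenM => //; first by constructor.
    by apply: FlatGenM; exact: FlatGenV.
  move=> t; have := is_deriveV (f0 t) (df t).
  by congr (is_derive _ _ _ _); rewrite /GRing.scale/= mulN1r -invfM -expr2.
- exists (fun t => f' (a * t + b) * a).
    by apply: FlatGenM; constructor.
  move=> t; have dl : is_derive t 1 (fun t : R => a * t + b) a.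
    have := is_deriveD (is_deriveZ a (is_derive_id t 1)) (is_derive_cst b t 1).
    by congr (is_derive _ _ _ _); rewrite addr0 /GRing.scale/= mulr1.
  exact: (is_derive1_comp (df _) dl).
Qed.

Lemma flat_generated_derive1n {R : realType} (f : R -> R) n :
  flat_generated f -> flat_generated (derive1n n f).
Proof.
move=> fS; elim: n => [//|n /flat_generated_is_derive[g' g'S dg]].
rewrite derive1nS (_ : derive1 _ = g')//.
by apply/funext => t; rewrite derive1E (@derive_val _ _ _ _ _ _ _ (dg t)).
Qed.

Lemma flat_generated_derivable1n {R : realType} (f : R -> R) n x :
  flat_generated f -> derivable (derive1n n f) x 1.
Proof.
by move=> /(flat_generated_derive1n n)/flat_generated_is_derive[g' _ /(_ x)[]].
Qed.

Lemma flat_generated_continuous {R : realType} (f : R -> R) :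
  flat_generated f -> continuous f.
Proof.
move=> /(@flat_generated_derivable1n _ _ 0) fd x.
exact/differentiable_continuous/derivable1_diffP.
Qed.

Lemma nondecreasing_flat0 {R : realType} : {homo @flat R 0 : x y / x <= y}.
Proof.
move=> x y xy; have [x0|x0] := ltP 0 x; last first.
  by rewrite {1}/flat ltNge x0; exact: flat_ge0.
rewrite /flat x0 (lt_le_trans x0 xy) !expr0 !mul1r ler_expR lerN2.
by rewrite lef_pV2// posrE// (lt_le_trans x0).
Qed.

(** The usual quotient [f(t) / (f(t) + f(1 - t))] with [f = flat 0]; [1 - t] is spelled as an affine
    map to fit [FlatGenAff]. *)
Definition smooth_step {R : realType} (t : R) : R :=
  flat 0 t * (flat 0 t + flat 0 (-1 * t + 1))^-1.

Lemma smooth_step_den_gt0 {R : realType} (t : R) :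
  0 < flat 0 t + flat 0 (-1 * t + 1).
Proof.
have flat_gt0 (s : R) : 0 < s -> 0 < flat 0 s.
  by rewrite /flat => ->; rewrite expr0 mul1r expR_gt0.
have [t0|t0] := ltP 0 t; first by rewrite ltr_pwDl ?flat_ge0 ?flat_gt0.
by rewrite ltr_wpDl ?flat_ge0// flat_gt0//; lra.
Qed.

Lemma smooth_step_flat_generated {R : realType} :
  flat_generated (@smooth_step R).
Proof.
apply: FlatGenM; first by constructor.
apply: FlatGenV => [t|]; first by rewrite gt_eqF ?smooth_step_den_gt0.
by apply: FlatGenD; [constructor|apply: FlatGenAff; constructor].
Qed.

Lemma smooth_step_le0 {R : realType} (t : R) : t <= 0 -> smooth_step t = 0.
Proof. by move=> t0; rewrite /smooth_step {1}/flat ltNge t0 mul0r. Qed.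

Lemma smooth_step_ge1 {R : realType} (t : R) : 1 <= t -> smooth_step t = 1.
Proof.
move=> t1; rewrite /smooth_step.
have flat0 : flat 0 (-1 * t + 1) = 0 by rewrite /flat ltNge (_ : _ <= 0)//; lra.
rewrite flat0 addr0 divff// gt_eqF//.
by have := smooth_step_den_gt0 t; rewrite flat0 addr0.
Qed.

(** After cross-multiplication the claim is [f(x) * f(1 - y) <= f(y) * f(1 - x)] for [f = flat 0],
    which is nonnegative and nondecreasing. *)
Lemma nondecreasing_smooth_step {R : realType} :
  {homo @smooth_step R : x y / x <= y}.
Proof.
move=> x y xy; rewrite /smooth_step.
have fxy := nondecreasing_flat0 xy.
have gxy : flat 0 (-1 * y + 1) <= flat 0 (-1 * x + 1).
  by apply: nondecreasing_flat0; lra.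
rewrite ler_pdivrMr ?smooth_step_den_gt0// mulrAC ler_pdivlMr ?smooth_step_den_gt0//.
have := @flat_ge0 _ 0 x; have := @flat_ge0 _ 0 (-1 * y + 1).
nra.
Qed.

Lemma smooth_step_itv {R : realType} (t : R) : 0 <= smooth_step t <= 1.
Proof.
have [t0|t0] := leP t 0; first by rewrite smooth_step_le0// lexx ler01.
have [t1|t1] := leP 1 t; first by rewrite smooth_step_ge1// lexx ler01.
rewrite -[X in X <= _ <= _](@smooth_step_le0 _ 0)//.
rewrite -[X in _ <= _ <= X](@smooth_step_ge1 _ 1)//.
by rewrite !nondecreasing_smooth_step// ltW.
Qed.

Lemma nondecreasing_derive1_ge0 {R : realType} (f : R -> R) (x : R) :
  {homo f : x y / x <= y} -> derivable f x 1 -> 0 <= derive1 f x.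
Proof.
move=> ndf df; rewrite derive1E /derive; apply: limr_ge => //.
apply: nearW => h; rewrite /GRing.scale/= mulr1.
have [h0|h0] := leP 0 h.
  by rewrite mulr_ge0 ?invr_ge0// subr_ge0 ndf// lerDr.
by rewrite nmulr_rge0 ?invr_lt0// subr_le0 ndf// gerDr ltW.
Qed.

Lemma near_cst_derive1 {R : realType} (f : R -> R) (k x : R) :
  (\near x, f x = k) -> derive1 f x = 0.
Proof.
move=> fk; rewrite derive1E (@near_eq_derive _ _ _ f (cst k)) ?oner_neq0//.
exact: derive_cst.
Qed.

(** For [0 < e], a smooth passage from 0 to 1 over [[x, x + e]]; its derivative serves as the
    approximate identity at [x]. *)
Definition ramp {R : realType} (x e t : R) : R := smooth_step (e^-1 * t + - (x / e)).

Lemma ramp_flat_generated {R : realType} (x e : R) : flat_generated (ramp x e).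
Proof. exact/FlatGenAff/smooth_step_flat_generated. Qed.

Lemma derivable_ramp {R : realType} (x e t : R) : derivable (ramp x e) t 1.
Proof. exact/(@flat_generated_derivable1n _ _ 0)/ramp_flat_generated. Qed.

Lemma continuous_derive1_ramp {R : realType} (x e : R) : continuous (derive1 (ramp x e)).
Proof.
exact/flat_generated_continuous/(@flat_generated_derive1n _ _ 1)/ramp_flat_generated.
Qed.

Section ramp.
Context {R : realType} (x e : R).
Hypothesis e0 : 0 < e.

Let rampE t : e^-1 * t + - (x / e) = (t - x) / e.
Proof. by field; rewrite gt_eqF. Qed.

Lemma ramp_le t : t <= x -> ramp x e t = 0.
Proof.
move=> tx; rewrite /ramp rampE smooth_step_le0//.
by rewrite pmulr_lle0 ?invr_gt0// subr_le0.
Qed.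

Lemma ramp_ge t : x + e <= t -> ramp x e t = 1.
Proof.
move=> xt; rewrite /ramp rampE smooth_step_ge1//.
by rewrite ler_pdivlMr// mul1r lerBrDl.
Qed.

Lemma nondecreasing_ramp : {homo ramp x e : s t / s <= t}.
Proof.
move=> s t st; apply: nondecreasing_smooth_step.
by rewrite lerD2r ler_pM2l ?invr_gt0.
Qed.

Lemma derive1_ramp_ge0 t : 0 <= derive1 (ramp x e) t.
Proof.
by apply: nondecreasing_derive1_ge0; [exact: nondecreasing_ramp|exact: derivable_ramp].
Qed.

Lemma derive1_ramp_out t : ~~ (x <= t <= x + e) -> derive1 (ramp x e) t = 0.
Proof.
rewrite negb_and -!ltNge => /orP[tx|xet].
  apply: (@near_cst_derive1 _ _ 0); near=> s; apply/ramp_le/ltW.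
  by near: s; exact: lt_nbhsl.
apply: (@near_cst_derive1 _ _ 1); near=> s; apply/ramp_ge/ltW.
by near: s; exact: lt_nbhsr.
Unshelve. all: by end_near. Qed.

Lemma ramp_itv t : 0 <= ramp x e t <= 1.
Proof. exact: smooth_step_itv. Qed.

End ramp.

(** * Integration on a segment, mollification and plateau test functions *)

Lemma within_continuous_integrable {R : realType} (c d : R) (f : R -> R) :
  {within `[c, d], continuous f} ->
  (@lebesgue_measure R).-integrable `[c, d] (EFin \o f).
Proof. exact/continuous_compact_integrable/segment_compact. Qed.

Lemma is_derive_LRcontinuous {R : realType} (c d : R) (f F : R -> R) :
  (forall t : R, is_derive t 1 F (f t)) -> derivable_oo_LRcontinuous F c d.
Proof.
move=> dF; have Fc t : {for t, continuous F}.
  by apply/differentiable_continuous/derivable1_diffP; case: (dF t).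
split; first by move=> t _; case: (dF t).
- exact/cvg_at_right_filter/Fc.
- exact/cvg_at_left_filter/Fc.
Qed.

Lemma is_derive_derive1 {R : realType} (f F : R -> R) :
  (forall t : R, is_derive t 1 F (f t)) -> derive1 F = f.
Proof.
by move=> dF; apply/funext => t; rewrite derive1E (@derive_val _ _ _ _ _ _ _ (dF t)).
Qed.

Lemma Rintegral_FTC2 {R : realType} (c d : R) (f F : R -> R) : c < d ->
  {within `[c, d], continuous f} -> (forall t : R, is_derive t 1 F (f t)) ->
  \int[@lebesgue_measure R]_(t in `[c, d]) f t = F d - F c.
Proof.
move=> cd cf dF; rewrite /Rintegral (@continuous_FTC2 _ f F)//.
  exact: is_derive_LRcontinuous dF.
by move=> t _; rewrite (is_derive_derive1 dF).
Qed.

Lemma Rintegral_derive1_ramp {R : realType} (c d x e : R) :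
  0 < e -> c <= x -> x + e <= d ->
  \int[@lebesgue_measure R]_(t in `[c, d]) derive1 (ramp x e) t = 1.
Proof.
move=> e0 cx xd; have cd : c < d by lra.
have cr : {within `[c, d], continuous (derive1 (ramp x e))}.
  exact/continuous_subspaceT/continuous_derive1_ramp.
have dr (t : R) : is_derive t 1 (ramp x e) (derive1 (ramp x e) t).
  by rewrite derive1E; exact/derivableP/derivable_ramp.
by rewrite (Rintegral_FTC2 cd cr dr) ramp_ge// ramp_le// subr0.
Qed.

(** The derivative of the ramp is nonnegative, has mass 1 and vanishes off [[x, x + e]], so the
    integral is a weighted average of values of [u] that are [eta]-close to [u x]. *)
Lemma mollify_le {R : realType} (c d x e eta : R) (u : R -> R) :
  0 < e -> c <= x -> x + e <= d -> {within `[c, d], continuous u} ->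
  (forall t, x <= t <= x + e -> `|u t - u x| <= eta) ->
  `|\int[@lebesgue_measure R]_(t in `[c, d]) (u t * derive1 (ramp x e) t) - u x| <= eta.
Proof.
move=> e0 cx xd cu uxe.
have cr : {within `[c, d], continuous (derive1 (ramp x e))}.
  exact/continuous_subspaceT/continuous_derive1_ramp.
have cM (f : R -> R) : {within `[c, d], continuous f} ->
    {within `[c, d], continuous (fun t => f t * derive1 (ramp x e) t)}.
  by move=> cf t; apply: continuousM; [exact: cf|exact: cr].
have ccst (k : R) : {within `[c, d], continuous (fun=> k)}.
  by apply: continuous_subspaceT => t; exact: cvg_cst.
have cD : {within `[c, d], continuous (fun t => u t - u x)}.
  by move=> t; apply: continuousB; [exact: cu|exact: ccst].
have int1 := Rintegral_derive1_ramp e0 cx xd.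
(* Multiplying [u x] by the mass 1 of the kernel brings both terms under one integral. *)
rewrite -[X in _ - X]mulr1 -{}[in X in _ - X]int1.
rewrite -RintegralZl//; last exact: within_continuous_integrable.
rewrite -RintegralB//; [|exact/within_continuous_integrable/cM..].
under eq_Rintegral do rewrite -mulrBl.
apply: le_trans; first apply: le_normr_Rintegral => //.
  exact/within_continuous_integrable/cM.
rewrite -[leRHS]mulr1 -[X in _ <= _ * X](Rintegral_derive1_ramp e0 cx xd).
rewrite -RintegralZl//; last exact: within_continuous_integrable.
apply: le_Rintegral => //.
- apply: within_continuous_integrable => t.
  have /continuous_comp := cM _ cD t; apply.
  exact: norm_continuous.
- exact/within_continuous_integrable/cM.
move=> t _; have [xt|xt] := boolP (x <= t <= x + e); last first.
  by rewrite derive1_ramp_out// !mulr0 normr0.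
by rewrite normrM (ger0_norm (derive1_ramp_ge0 _ _ _))// ler_wpM2r ?derive1_ramp_ge0 ?uxe.
Qed.

(** A smooth approximation of the indicator of [[x, y]]. The factor [-1] in place of a subtraction
    matches the constructors of [flat_generated]. *)
Definition plateau {R : realType} (x y e t : R) : R :=
  ramp x e t + -1 * ramp y e t.

Lemma plateau_out {R : realType} (x y e t : R) : 0 < e -> x <= y ->
  ~~ (x <= t <= y + e) -> plateau x y e t = 0.
Proof.
move=> e0 xy; rewrite negb_and -!ltNge /plateau => /orP[tx|yet].
  by rewrite !ramp_le ?mulr0 ?addr0//; lra.
by rewrite !ramp_ge//; lra.
Qed.

Lemma plateau_itv {R : realType} (x y e t : R) : 0 < e -> x <= y ->
  0 <= plateau x y e t <= 1.
Proof.
move=> e0 xy; have /andP[? ?] := @ramp_itv _ x e t.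
have /andP[? ?] := @ramp_itv _ y e t.
rewrite /plateau; suff : ramp y e t <= ramp x e t by move=> ?; apply/andP; split; lra.
apply: nondecreasing_smooth_step.
by rewrite lerD2l lerN2 ler_pM2r ?invr_gt0.
Qed.

Lemma test_function_plateau {R : realType} (c d x y e : R) : 0 < e ->
  c < x -> x <= y -> y + e < d -> test_function c d (plateau x y e).
Proof.
move=> e0 cx xy yd; split.
  move=> n t; apply: flat_generated_derivable1n.
  apply: FlatGenD; first exact: ramp_flat_generated.
  by apply: FlatGenM; [exact: FlatGenCst|exact: ramp_flat_generated].
have sub : closure [set t | plateau x y e t != 0] `<=` `[x, y + e].
  rewrite [X in _ `<=` X](closure_id _).1; last exact: interval_closed.
  apply: closureS => t /=; apply: contraNT => xt.
  by rewrite plateau_out//; move: xt; rewrite in_itv.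
split.
  by apply: subclosed_compact sub => //; [exact: closed_closure|exact: segment_compact].
move=> t /sub /=; rewrite !in_itv/= => /andP[xt ty].
by apply/andP; split; lra.
Qed.

(** * Lipschitz continuity from an essentially bounded weak derivative *)

(** The norm of exponent [+oo] unfolds to an essential supremum only on a space of positive
    measure. *)
Lemma lebesgue_measure_setT_gt0 {R : realType} :
  (0 < @lebesgue_measure R [set: R])%E.
Proof. by rewrite -set_itvNyy lebesgue_measure_itv/= ltry. Qed.

Lemma Linfty_norm_ae {R : realType} (D : set R) (v : R -> R) (M : R) :
  (Linfty_norm D v <= M%:E)%E ->
  {ae @lebesgue_measure R, forall x, D x -> `|v x| <= M}.
Proof.
rewrite /Linfty_norm unlock lebesgue_measure_setT_gt0 => /ess_supP.
apply: filterS => x /= + Dx.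
by rewrite lee_fin patchE mem_set.
Qed.

Lemma weak_derivative_le {R : realType} (c d M : R) (u v phi : R -> R) :
  weak_derivative c d u v -> (Linfty_norm `[c, d] v <= M%:E)%E -> 0 <= M ->
  test_function c d phi -> (forall t, 0 <= phi t) ->
  `|\int[@lebesgue_measure R]_(t in `[c, d]) (u t * derive1 phi t)| <=
  M * \int[@lebesgue_measure R]_(t in `[c, d]) phi t.
Proof.
move=> [[mv _ _] wd] /Linfty_norm_ae vM M0 tphi phi0.
rewrite wd// normrN.
have cphi : {within `[c, d], continuous phi}.
  apply: continuous_subspaceT => t; apply/differentiable_continuous.
  by apply/derivable1_diffP; exact: (tphi.1 0%N).
have iphi := within_continuous_integrable cphi.
have mphi : measurable_fun `[c, d] phi.
  by apply/measurable_EFinP; exact: measurable_int iphi.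
have mvphi : measurable_fun `[c, d] (fun t => v t * phi t).
  by apply: measurable_funM => //; exact: measurable_fun_itv_cc mv.
have vMphi : {ae @lebesgue_measure R, forall t, `[c, d]%classic t ->
    (`|(v t * phi t)%:E| <= (M * phi t)%:E)%E}.
  move: vM; apply: filterS; first exact: (ae_filter_ringOfSetsType lebesgue_measure).
  move=> t vM tcd.
  by rewrite /= lee_fin normrM (ger0_norm (phi0 t)) ler_wpM2r// vM.
rewrite -RintegralZl//.
(* The estimate is made in the extended reals first: it is what shows that the integral of [v * phi]
   is finite, after which it descends to the reals. *)
have le : (`|\int[@lebesgue_measure R]_(t in `[c, d]) (v t * phi t)%:E| <=
    (\int[@lebesgue_measure R]_(t in `[c, d]) (M * phi t))%:E)%E.
  rewrite /Rintegral fineK; last first.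
    by apply: integrable_fin_num => //; exact: (integrableZl _ M iphi).
  apply: le_trans; first by apply: le_abse_integral => //; exact/measurable_EFinP.
  apply: ae_ge0_le_integral => //.
  - by apply: measurableT_comp => //; exact/measurable_EFinP.
  - by move=> t _; rewrite lee_fin mulr_ge0.
  - by apply/measurable_EFinP/measurable_funM => //.
have fin : (\int[@lebesgue_measure R]_(t in `[c, d]) (v t * phi t)%:E)%E \is a fin_num.
  by rewrite fin_num_abs (le_lt_trans le)// ltry.
by rewrite -lee_fin (le_trans _ le)// /Rintegral -[X in (_ <= `|X|)%E]fineK.
Qed.

Lemma continuous_plateau {R : realType} (x y e : R) : continuous (plateau x y e).
Proof.
apply: flat_generated_continuous; apply: FlatGenD; first exact: ramp_flat_generated.
by apply: FlatGenM; [exact: FlatGenCst|exact: ramp_flat_generated].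
Qed.

Lemma derive1_plateau {R : realType} (x y e t : R) :
  derive1 (plateau x y e) t = derive1 (ramp x e) t - derive1 (ramp y e) t.
Proof.
have -> : plateau x y e = ramp x e - ramp y e.
  by apply/funext => s; rewrite /plateau mulN1r.
by rewrite !derive1E deriveB//; exact: derivable_ramp.
Qed.

Lemma Rintegral_subitv {R : realType} (c d q r : R) (f : R -> R) :
  c <= q -> r <= d ->
  (forall t, c <= t <= d -> ~~ (q <= t <= r) -> f t = 0) ->
  \int[@lebesgue_measure R]_(t in `[c, d]) f t =
  \int[@lebesgue_measure R]_(t in `[q, r]) f t.
Proof.
move=> cq rd f0; rewrite Rintegral_mkcond [RHS]Rintegral_mkcond.
congr (Rintegral _ _ _); apply/funext => t; rewrite !patchE !mem_setE !in_itv/=.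
case: ifPn => [tcd|tcd]; case: ifPn => // tqr; first by rewrite f0.
by case/negP: tcd; move: tqr => /andP[? ?]; apply/andP; split; lra.
Qed.

Lemma Rintegral_plateau_le {R : realType} (c d x y e : R) : 0 < e ->
  c <= x -> x <= y -> y + e <= d ->
  \int[@lebesgue_measure R]_(t in `[c, d]) plateau x y e t <= y + e - x.
Proof.
move=> e0 cx xy yd.
rewrite (Rintegral_subitv cx yd); last by move=> t _; exact: plateau_out.
have -> : y + e - x = \int[@lebesgue_measure R]_(t in `[x, y + e]) 1.
  rewrite Rintegral_cst//= lebesgue_measure_itv/= lte_fin mul1r.
  by case: ifPn => //; lra.
apply: le_Rintegral => //.
- exact/within_continuous_integrable/continuous_subspaceT/continuous_plateau.
- apply/within_continuous_integrable/continuous_subspaceT => t; exact: cvg_cst.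
- by move=> t _; have /andP[] := plateau_itv t e0 xy.
Qed.

Lemma Linfty_norm_ge0 {R : realType} (D : set R) (v : R -> R) :
  (0 <= Linfty_norm D v)%E.
Proof. exact: Lnorm_ge0. Qed.

(** Testing against a plateau gives an integral close to [u x - u y] and bounded by
    [M * (y + e - x)]. Interior points leave room for the support of the plateau in the open
    interval. *)
Lemma weak_derivative_lipschitz_oo {R : realType} (c d M : R) (u v : R -> R) :
  {within `[c, d], continuous u} -> weak_derivative c d u v ->
  (Linfty_norm `[c, d] v <= M%:E)%E ->
  forall x y, c < x -> x <= y -> y < d -> `|u x - u y| <= M * (y - x).
Proof.
move=> cu wd vM x y cx xy yd.
have M0 : 0 <= M by rewrite -lee_fin (le_trans (Linfty_norm_ge0 _ _) vM).
apply/ler_addgt0Pr => eta' eta'0.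
(* The total error is [eta] at [x], [eta] at [y], and [M * e <= M * eta] from the width of the
   second ramp. *)
pose eta := eta' / (M + 2).
have eta0 : 0 < eta by rewrite divr_gt0//; lra.
have cd : c < d by lra.
have [cuoo _ _] := (continuous_within_itvP _ cd).1 cu.
have near_u z : c < z < d -> \forall e \near 0^'+,
    z + e < d /\ forall t, z <= t <= z + e -> `|u t - u z| <= eta.
  move=> zcd.
  have /cvgrPdist_le/(_ _ eta0) : {for z, continuous u} by apply: cuoo; rewrite in_itv.
  move=> /nbhs_normP[r /= r0 rP].
  near=> e; split.
    by rewrite -ltrBrDl; near: e; apply: nbhs_right_lt; rewrite subr_gt0; case/andP: zcd.
  move=> t /andP[zt te]; rewrite distrC; apply: rP.
  rewrite /= distrC ger0_norm ?subr_ge0//.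
  have : e < r by near: e; exact: nbhs_right_lt.
  lra.
have [e /= [e0 ee [xd ux] [yd' uy]]] : exists e, [/\ 0 < e, e <= eta,
    x + e < d /\ (forall t, x <= t <= x + e -> `|u t - u x| <= eta) &
    y + e < d /\ (forall t, y <= t <= y + e -> `|u t - u y| <= eta)].
  near (0 : R)^'+ => e; exists e; split.
  - by near: e; exact: nbhs_right_gt.
  - by near: e; exact: nbhs_right_le.
  - by near: e; apply: near_u; lra.
  - by near: e; apply: near_u; lra.
have := weak_derivative_le wd vM M0 (test_function_plateau e0 cx xy yd')
  (fun t => (andP (plateau_itv t e0 xy)).1).
under eq_Rintegral do rewrite derive1_plateau mulrBr.
have cM z : (@lebesgue_measure R).-integrable `[c, d]
    (EFin \o (fun t => u t * derive1 (ramp z e) t)).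
  apply: within_continuous_integrable => t; apply: continuousM; first exact: cu.
  exact/continuous_subspaceT/continuous_derive1_ramp.
rewrite RintegralB//.
have cx' := ltW cx; have cy' : c <= y by lra.
have mx := mollify_le e0 cx' (ltW xd) cu ux.
have my := mollify_le e0 cy' (ltW yd') cu uy.
have Mp := ler_wpM2l M0 (Rintegral_plateau_le e0 cx' xy (ltW yd')).
have etaE : eta' = eta * M + 2 * eta.
  by rewrite [2 * _]mulrC -mulrDr divfK// gt_eqF//; lra.
have Me : M * e <= M * eta by rewrite ler_wpM2l.
move=> /le_trans /(_ Mp); move: mx my.
(* The integrals and the values of [u] are abstracted, which leaves a purely linear inequality. *)
have arith (I J a b : R) : `|I - a| <= eta -> `|J - b| <= eta ->
    `|I - J| <= M * (y + e - x) -> `|a - b| <= M * (y - x) + eta'.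
  rewrite !ler_norml => /andP[? ?] /andP[? ?] /andP[? ?].
  by apply/andP; split; lra.
exact: arith.
Unshelve. all: by end_near. Qed.

(** The interior estimate extends to the endpoints by one-sided continuity of [u]. *)
Lemma weak_derivative_lipschitz {R : realType} (c d M : R) (u v : R -> R) :
  {within `[c, d], continuous u} -> weak_derivative c d u v ->
  (Linfty_norm `[c, d] v <= M%:E)%E ->
  forall x y, c <= x -> x <= y -> y <= d -> `|u x - u y| <= M * (y - x).
Proof.
move=> cu wd vM x y cx xy yd.
have [<-|xy' ] := eqVneq x y; first by rewrite !subrr normr0 mulr0.
have {xy xy'} xy : x < y by rewrite lt_neqAle xy' xy.
have cd : c < d by lra.
have [cuoo cuc cud] := (continuous_within_itvP _ cd).1 cu.
have M0 : 0 <= M by rewrite -lee_fin (le_trans (Linfty_norm_ge0 _ _) vM).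
have cux : u @ x^'+ --> u x.
  move: cx; rewrite le_eqVlt => /predU1P[<-//|cx].
  by apply/cvg_at_right_filter/cuoo; rewrite in_itv/= cx/=; lra.
have cuy : u @ y^'- --> u y.
  move: yd; rewrite le_eqVlt => /predU1P[->//|yd].
  by apply/cvg_at_left_filter/cuoo; rewrite in_itv/= yd andbT; lra.
have xy2 : x < (x + y) / 2 < y by lra.
apply/ler_addgt0Pr => eta eta0; have eta20 : 0 < eta / 2 by lra.
(* The approximants [s] of [x] and [t] of [y] are kept on either side of the midpoint, so that
   [s <= t]. *)
have [s [xs sy us]] : exists s, [/\ x < s, s <= (x + y) / 2 & `|u x - u s| <= eta / 2].
  near x^'+ => s; exists s; split.
  - by near: s; exact: nbhs_right_gt.
  - by near: s; apply: nbhs_right_le; case/andP: xy2.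
  - by near: s; move/cvgrPdist_le : cux; exact.
have [t [ty xt ut]] : exists t, [/\ t < y, (x + y) / 2 <= t & `|u y - u t| <= eta / 2].
  near y^'- => t; exists t; split.
  - by near: t; exact: nbhs_left_lt.
  - by near: t; apply: nbhs_left_ge; case/andP: xy2.
  - by near: t; move/cvgrPdist_le : cuy; exact.
have cs : c < s by lra.
have st : s <= t by lra.
have td : t < d by lra.
have := weak_derivative_lipschitz_oo cu wd vM cs st td.
have : M * (t - s) <= M * (y - x) by rewrite ler_wpM2l//; lra.
move: us ut; rewrite !ler_norml => /andP[? ?] /andP[? ?] ? /andP[? ?].
by apply/andP; split; lra.
Unshelve. all: by end_near. Qed.

(** * Tent densities *)

Lemma L1_normE {R : realType} (c d : R) (u : R -> R) :
  {within `[c, d], continuous u} ->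
  {ae @lebesgue_measure R, forall x : R, x \in `[c, d] -> 0 <= u x} ->
  L1_norm `[c, d] u = (\int[@lebesgue_measure R]_(x in `[c, d]) u x)%:E.
Proof.
move=> cu u0; have iu := within_continuous_integrable cu.
have mu := measurable_int _ iu.
rewrite /L1_norm Lnorm1 /Rintegral fineK; last exact: integrable_fin_num.
rewrite [RHS](_ : _ = \int[@lebesgue_measure R]_(x in `[c, d]) `|(u x)%:E|)%E.
  rewrite [RHS]integral_mkcond; apply: eq_integral => x _ /=.
  by rewrite !patchE; case: ifPn => //; rewrite normr0.
apply: ae_eq_integral => //; first exact: measurableT_comp.
move: u0; apply: filterS; first exact: (ae_filter_ringOfSetsType lebesgue_measure).
by move=> x u0 xcd; rewrite /= ger0_norm// u0.
Qed.

Lemma Linfty_norm_le {R : realType} (D : set R) (v : R -> R) (M : R) :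
  0 <= M -> (forall x, D x -> `|v x| <= M) -> (Linfty_norm D v <= M%:E)%E.
Proof.
move=> M0 vM; rewrite /Linfty_norm unlock lebesgue_measure_setT_gt0.
apply/ess_supP; apply: aeW => x /=; rewrite lee_fin patchE.
by case: ifPn => [/set_mem/vM//|_]; rewrite normr0.
Qed.

Lemma Linfty_bounded {R : realType} (D : set R) (v : R -> R) (M : R) :
  measurable D -> measurable_fun D v -> 0 <= M ->
  (forall x, D x -> `|v x| <= M) -> Linfty D v.
Proof.
move=> mD mv M0 vM; rewrite /Linfty inE; apply/andP; split; rewrite inE/=.
  exact/(measurable_restrictT _ mD).
by rewrite /finite_norm (le_lt_trans (Linfty_norm_le M0 vM))// ltry.
Qed.

(** * Test functions and weak derivatives of piecewise affine functions *)

Lemma test_function_out {R : realType} (c d t : R) (phi : R -> R) :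
  test_function c d phi -> ~~ (c < t < d) -> phi t = 0.
Proof.
move=> [_ [_ sub]] tcd; apply/eqP; apply: contraNT tcd => phit.
by have := sub t (@subset_closure _ [set x | phi x != 0] t phit); rewrite /= in_itv.
Qed.

Lemma test_function_is_derive {R : realType} (c d t : R) (phi : R -> R) :
  test_function c d phi -> is_derive t 1 phi (derive1 phi t).
Proof. by move=> [dphi _]; rewrite derive1E; exact/derivableP/(dphi 0%N). Qed.

Lemma test_function_continuous {R : realType} (c d : R) (phi : R -> R) :
  test_function c d phi -> continuous phi /\ continuous (derive1 phi).
Proof.
move=> [dphi _]; split=> t; apply/differentiable_continuous/derivable1_diffP.
  exact: (dphi 0%N).
exact: (dphi 1%N).
Qed.

Definition pos_part {R : realType} (q t : R) : R := Num.max 0 (t - q).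

Lemma continuous_pos_part {R : realType} (q : R) : continuous (pos_part q).
Proof.
move=> t; apply: (@continuous_max R _ (fun=> 0) (fun t => t - q)); first exact: cvg_cst.
by apply: continuousB; [exact: cvg_id|exact: cvg_cst].
Qed.

(** Both integrands vanish left of [q]. Integration by parts on [[q, d]] leaves no boundary term,
    since [t - q] vanishes at [q] and [phi] at [d]. *)
Lemma weak_derivative_pos_part {R : realType} (c d q : R) (phi : R -> R) :
  c <= q -> q <= d -> test_function c d phi ->
  \int[@lebesgue_measure R]_(t in `[c, d]) (pos_part q t * derive1 phi t) =
  - \int[@lebesgue_measure R]_(t in `[c, d]) (\1_`[q, +oo[ t * phi t).
Proof.
move=> cq qd tphi.
have [cphi cdphi] := test_function_continuous tphi.
have pos0 t : c <= t <= d -> ~~ (q <= t <= d) -> pos_part q t * derive1 phi t = 0.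
  move=> /andP[_ td]; rewrite td andbT -ltNge => tq.
  by rewrite /pos_part max_l ?mul0r//; lra.
have ind0 t : c <= t <= d -> ~~ (q <= t <= d) -> \1_`[q, +oo[ t * phi t = 0.
  move=> /andP[_ td]; rewrite td andbT => tq.
  by rewrite indicE mem_setE in_itv/= andbT (negbTE tq) mul0r.
rewrite (Rintegral_subitv cq (lexx d) pos0) (Rintegral_subitv cq (lexx d) ind0).
have -> : \int[@lebesgue_measure R]_(t in `[q, d]) (pos_part q t * derive1 phi t) =
    \int[@lebesgue_measure R]_(t in `[q, d]) ((t - q) * derive1 phi t).
  apply: eq_Rintegral => t; rewrite inE/= in_itv/= => /andP[qt _].
  by rewrite /pos_part max_r// subr_ge0.
have -> : \int[@lebesgue_measure R]_(t in `[q, d]) (\1_`[q, +oo[ t * phi t) =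
    \int[@lebesgue_measure R]_(t in `[q, d]) (1 * phi t).
  apply: eq_Rintegral => t; rewrite inE/= in_itv/= => /andP[qt _].
  by rewrite indicE mem_setE in_itv/= andbT qt.
(* Integration by parts is applied on a nondegenerate interval; for [q = d] both integrals are over
   a point. *)
move: qd; rewrite le_eqVlt => /predU1P[<-|qd].
  by rewrite set_itv1 !Rintegral_set1 oppr0.
have dlin (t : R) : is_derive t 1 (fun t => t - q) 1.
  by apply: is_derive_eq; rewrite subr0.
have dphi (t : R) := test_function_is_derive t tphi.
rewrite (@Rintegration_by_parts _ (fun t => t - q) phi (fun=> 1) (derive1 phi))//.
- rewrite (test_function_out (t := d) tphi) ?ltxx ?andbF//.
  by rewrite subrr mulr0 mul0r subrr sub0r.
- by apply: continuous_subspaceT => t; exact: cvg_cst.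
- exact: is_derive_LRcontinuous dlin.
- by move=> t _; rewrite (is_derive_derive1 dlin).
- exact: continuous_subspaceT.
- exact: is_derive_LRcontinuous dphi.
Qed.

Lemma Rintegral_pos_part {R : realType} (c d q : R) : c <= q -> q <= d ->
  \int[@lebesgue_measure R]_(t in `[c, d]) pos_part q t = (d - q) ^+ 2 / 2.
Proof.
move=> cq qd.
rewrite (Rintegral_subitv cq (lexx d)); last first.
  move=> t /andP[_ td]; rewrite td andbT -ltNge => tq.
  by rewrite /pos_part max_l//; lra.
have -> : \int[@lebesgue_measure R]_(t in `[q, d]) pos_part q t =
    \int[@lebesgue_measure R]_(t in `[q, d]) (t - q).
  apply: eq_Rintegral => t; rewrite inE/= in_itv/= => /andP[qt _].
  by rewrite /pos_part max_r// subr_ge0.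
move: qd; rewrite le_eqVlt => /predU1P[<-|qd].
  by rewrite set_itv1 !Rintegral_set1 subrr expr0n/= mul0r.
have dlin (t : R) : is_derive t 1 (fun t => t - q) 1.
  by apply: is_derive_eq; rewrite subr0.
have dF (t : R) : is_derive t 1 (fun t => (t - q) * ((t - q) / 2)) (t - q).
  have dlin2 : is_derive t 1 (fun t => (t - q) / 2) (1 / 2).
    have := is_deriveM (dlin t) (is_derive_cst (2^-1 : R) t 1).
    by congr (is_derive _ _ _ _); rewrite /GRing.scale/= mulr0 add0r mulrC.
  have := is_deriveM (dlin t) dlin2.
  by congr (is_derive _ _ _ _); rewrite /GRing.scale/=; lra.
rewrite (Rintegral_FTC2 qd _ dF).
  by rewrite subrr mul0r subr0 mulrA.
apply: continuous_subspaceT => t.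
by apply: continuousB; [exact: cvg_id|exact: cvg_cst].
Qed.

(** For nonnegative [alpha] and [h]: peak [alpha * h] at [m], half-width [h], slopes [alpha] and
    [-alpha], hence mass [alpha * h^2]. *)
Definition tent {R : realType} (alpha h m t : R) : R :=
  alpha * Num.max 0 (h - `|t - m|).

(** For [0 <= h] this is [alpha] on [[m - h, m[], [-alpha] on [[m, m + h[] and 0 elsewhere, written
    so as to match [tentE] term by term. *)
Definition tent_slope {R : realType} (alpha h m t : R) : R :=
  alpha * (\1_`[m - h, +oo[ t - 2 * \1_`[m, +oo[ t + \1_`[m + h, +oo[ t).

(** A tent is a second difference of positive parts; its mass and its weak derivative then follow by
    linearity from those of [pos_part]. *)
Lemma tentE {R : realType} (alpha h m t : R) : 0 <= h ->
  tent alpha h m t =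
  alpha * (pos_part (m - h) t - 2 * pos_part m t + pos_part (m + h) t).
Proof.
move=> h0; rewrite /tent /pos_part; congr (_ * _).
have [tm|tm] := leP 0 (t - m).
  rewrite (ger0_norm tm) (max_r (_ : 0 <= t - (m - h))); last lra.
  have [?|?] := leP 0 (h - (t - m)).
    by rewrite max_l; lra.
  by rewrite max_r; lra.
rewrite (ltr0_norm tm) (max_l (_ : t - (m + h) <= 0)); last lra.
have [?|?] := leP 0 (h - - (t - m)).
  by rewrite max_r; lra.
by rewrite max_l; lra.
Qed.

Lemma tent_ge0 {R : realType} (alpha h m t : R) : 0 <= alpha ->
  0 <= tent alpha h m t.
Proof. by move=> a0; rewrite mulr_ge0// le_max lexx. Qed.

Lemma tent_out {R : realType} (alpha h m t : R) : h <= `|t - m| ->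
  tent alpha h m t = 0.
Proof. by move=> hm; rewrite /tent max_l ?mulr0// subr_le0. Qed.

Lemma continuous_tent {R : realType} (alpha h m : R) :
  continuous (tent alpha h m).
Proof.
move=> t; apply: (@continuousM _ _ (fun=> alpha) (fun t => Num.max 0 (h - `|t - m|))).
  exact: cvg_cst.
apply: (@continuous_max R _ (fun=> 0) (fun t => h - `|t - m|)); first exact: cvg_cst.
apply: continuousB; first exact: cvg_cst.
apply: (@continuous_comp _ _ _ (fun t => t - m) Num.norm).
  by apply: continuousB; [exact: cvg_id|exact: cvg_cst].
exact: norm_continuous.
Qed.

Lemma measurable_tent_slope {R : realType} (alpha h m : R) (D : set R) :
  measurable_fun D (tent_slope alpha h m).
Proof.
apply: measurable_funM => //; apply: measurable_funD => //.
apply: measurable_funB => //; apply: measurable_funM => //.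
Qed.

Lemma norm_tent_slope_le {R : realType} (alpha h m t : R) : 0 <= alpha ->
  0 <= h -> `|tent_slope alpha h m t| <= alpha.
Proof.
move=> a0 h0; rewrite /tent_slope normrM (ger0_norm a0) -[leRHS]mulr1 ler_wpM2l//.
rewrite !indicE !mem_setE !in_itv/= !andbT ler_norml.
by case: (leP (m - h) t) => ?; case: (leP m t) => ?; case: (leP (m + h) t) => ?;
  rewrite /=; apply/andP; split; lra.
Qed.

(** Linearity in the shape of [tentE], shared by the mass of the tent and both sides of its
    weak-derivative identity. *)
Lemma Rintegral_tent_comb {R : realType} (D : set R) (k : R) (f g l : R -> R) :
  measurable D ->
  (@lebesgue_measure R).-integrable D (EFin \o f) ->
  (@lebesgue_measure R).-integrable D (EFin \o g) ->
  (@lebesgue_measure R).-integrable D (EFin \o l) ->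
  \int[@lebesgue_measure R]_(t in D) (k * (f t - 2 * g t + l t)) =
  k * (\int[@lebesgue_measure R]_(t in D) f t -
       2 * \int[@lebesgue_measure R]_(t in D) g t +
       \int[@lebesgue_measure R]_(t in D) l t).
Proof.
move=> mD If Ig Il.
have I2g : (@lebesgue_measure R).-integrable D (EFin \o (fun t => 2 * g t)).
  exact: (integrableZl _ 2 Ig).
have Ifg : (@lebesgue_measure R).-integrable D (EFin \o (fun t => f t - 2 * g t)).
  exact: (integrableB _ If I2g).
have Ifgl : (@lebesgue_measure R).-integrable D
    (EFin \o (fun t => f t - 2 * g t + l t)).
  exact: (integrableD _ Ifg Il).
by rewrite RintegralZl// RintegralD// RintegralB// RintegralZl.
Qed.

Lemma weak_derivative_tent {R : realType} (c d alpha h m : R) : 0 <= alpha ->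
  0 <= h -> c <= m - h -> m + h <= d ->
  weak_derivative c d (tent alpha h m) (tent_slope alpha h m).
Proof.
move=> a0 h0 cm md; split.
  apply: open_integrable_locally; first exact: interval_open.
  apply: measurable_bounded_integrable => //.
  - by rewrite /= lebesgue_measure_itv/=; case: ifP => _; rewrite ltry.
  - exact: measurable_tent_slope.
  - exists alpha; split; first exact: num_real.
    move=> M aM t _; exact: le_trans (norm_tent_slope_le _ _ a0 h0) (ltW aM).
move=> phi tphi; have [cphi cdphi] := test_function_continuous tphi.
have iphi := within_continuous_integrable (@continuous_subspaceT _ _ `[c, d] _ cphi).
have Ip q : (@lebesgue_measure R).-integrable `[c, d]
    (EFin \o (fun t => pos_part q t * derive1 phi t)).
  apply/within_continuous_integrable/continuous_subspaceT => t.
  by apply: continuousM; [exact: continuous_pos_part|exact: cdphi].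
have Ii q : (@lebesgue_measure R).-integrable `[c, d]
    (EFin \o (fun t => \1_`[q, +oo[ t * phi t)).
  apply: le_integrable iphi => //.
    apply/measurable_EFinP; apply: measurable_funM => //.
    by apply: measurable_funTS; exact: continuous_measurable_fun.
  move=> t _; rewrite /= lee_fin normrM ler_piMl// indicE.
  by case: (_ \in _); rewrite ?normr1 ?normr0.
have tE t : tent alpha h m t * derive1 phi t =
    alpha * (pos_part (m - h) t * derive1 phi t -
      2 * (pos_part m t * derive1 phi t) + pos_part (m + h) t * derive1 phi t).
  by rewrite tentE//; ring.
have sE t : tent_slope alpha h m t * phi t =
    alpha * (\1_`[m - h, +oo[ t * phi t - 2 * (\1_`[m, +oo[ t * phi t) +
      \1_`[m + h, +oo[ t * phi t).
  by rewrite /tent_slope; ring.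
under eq_Rintegral do rewrite tE.
under [in RHS]eq_Rintegral do rewrite sE.
rewrite !Rintegral_tent_comb// !weak_derivative_pos_part//; [ring|lra..].
Qed.

Lemma Rintegral_tent {R : realType} (c d alpha h m : R) : 0 <= h ->
  c <= m - h -> m + h <= d ->
  \int[@lebesgue_measure R]_(t in `[c, d]) tent alpha h m t = alpha * h ^+ 2.
Proof.
move=> h0 cm md; under eq_Rintegral do rewrite tentE//.
have Ip q : (@lebesgue_measure R).-integrable `[c, d] (EFin \o pos_part q).
  exact/within_continuous_integrable/continuous_subspaceT/continuous_pos_part.
rewrite Rintegral_tent_comb// !Rintegral_pos_part//; [|lra..].
by field.
Qed.

Lemma densities_tent {R : realType} (c d alpha h m : R) : 0 <= alpha ->
  0 <= h -> alpha * h ^+ 2 = 1 -> c <= m - h -> m + h <= d ->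
  densities c d alpha (tent alpha h m).
Proof.
move=> a0 h0 ah cm md.
have wd := weak_derivative_tent a0 h0 cm md.
have ct : {within `[c, d], continuous (tent alpha h m)}.
  exact/continuous_subspaceT/continuous_tent.
have slope_le t := @norm_tent_slope_le _ alpha h m t a0 h0.
split.
- split => //.
  + split.
      apply: (@Linfty_bounded _ _ _ (alpha * h)) => //.
      * apply: measurable_funTS; apply: continuous_measurable_fun.
        exact: continuous_tent.
      * by rewrite mulr_ge0.
      * move=> t _; rewrite ger0_norm ?tent_ge0// ler_wpM2l// ge_max h0/=.
        by rewrite gerBl.
    exists (tent_slope alpha h m) => //.
    apply: (@Linfty_bounded _ _ _ alpha) => //.
    exact: measurable_tent_slope.
  + by apply: tent_out; rewrite ler0_norm; lra.
  + by apply: tent_out; rewrite ger0_norm; lra.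
- by apply: aeW => t _; exact: tent_ge0.
- rewrite L1_normE// ?Rintegral_tent ?ah//.
  by apply: aeW => t _; exact: tent_ge0.
- exists (tent_slope alpha h m) => //.
  exact: Linfty_norm_le.
Qed.

(** * Optimality of the tents *)

Lemma Rintegral_ae_ge0 {R : realType} (c d : R) (f : R -> R) :
  {within `[c, d], continuous f} ->
  {ae @lebesgue_measure R, forall x : R, x \in `[c, d] -> 0 <= f x} ->
  0 <= \int[@lebesgue_measure R]_(x in `[c, d]) f x.
Proof. by move=> cf f0; rewrite -lee_fin -L1_normE//; exact: Lnorm_ge0. Qed.

(* Equal masses turn the weight [y] into [y - z], which has the sign of [f - g]. *)
Lemma le_expectation_density {R : realType} (c d z : R) (f g : R -> R) :
  {within `[c, d], continuous f} -> {within `[c, d], continuous g} ->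
  \int[@lebesgue_measure R]_(y in `[c, d]) f y =
    \int[@lebesgue_measure R]_(y in `[c, d]) g y ->
  {ae @lebesgue_measure R, forall y : R, y \in `[c, d] ->
    0 <= (y - z) * (f y - g y)} ->
  expectation_density c d g <= expectation_density c d f.
Proof.
move=> cf cg fg ge0; rewrite -subr_ge0 /expectation_density.
have cB : {within `[c, d], continuous (fun y => f y - g y)}.
  by move=> t; apply: continuousB; [exact: cf|exact: cg].
have cid : {within `[c, d], continuous (fun y : R => y)}.
  by apply: continuous_subspaceT => t; exact: cvg_id.
have cz : {within `[c, d], continuous (fun=> z)}.
  by apply: continuous_subspaceT => t; exact: cvg_cst.
have cM (k l : R -> R) : {within `[c, d], continuous k} ->
    {within `[c, d], continuous l} -> {within `[c, d], continuous (fun y => k y * l y)}.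
  by move=> ck cl t; apply: continuousM; [exact: ck|exact: cl].
have cyz : {within `[c, d], continuous (fun y => y - z)}.
  by move=> t; apply: continuousB; [exact: cid|exact: cz].
have ici (k : R -> R) := @within_continuous_integrable _ c d k.
have -> : \int[@lebesgue_measure R]_(y in `[c, d]) (y * f y) -
    \int[@lebesgue_measure R]_(y in `[c, d]) (y * g y) =
    \int[@lebesgue_measure R]_(y in `[c, d]) ((y - z) * (f y - g y)).
  under [RHS]eq_Rintegral do rewrite mulrBl.
  rewrite RintegralB//; [|exact/ici/cM..].
  rewrite RintegralZl//; last exact: ici.
  rewrite [in X in _ - z * X]RintegralB//; [|exact: ici..].
  rewrite fg subrr mulr0 subr0.
  under [RHS]eq_Rintegral do rewrite mulrBr.
  by rewrite RintegralB//; exact/ici/cM.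
by apply: Rintegral_ae_ge0 => //; exact: cM.
Qed.

(* Left of its peak the tent grows at the maximal rate, so [tent - u] increases
   there; right of it the tent dominates every admissible [u]. *)
Lemma tent_right_crossing {R : realType} (c d alpha h : R) (u : R -> R) :
  0 <= alpha -> 0 <= h -> c <= d - h - h -> u d = 0 ->
  (forall x y, c <= x -> x <= y -> y <= d -> `|u x - u y| <= alpha * (y - x)) ->
  exists z, forall y, c <= y <= d -> 0 <= u y ->
    0 <= (y - z) * (tent alpha h (d - h) y - u y).
Proof.
move=> a0 h0 cd ud lip; set m := d - h; set p := m - h.
have tl y : p <= y <= m -> tent alpha h m y = alpha * (y - p).
  move=> /andP[py ym]; rewrite /tent ler0_norm ?subr_le0// max_r;
    last by move: py; rewrite /p; lra.
  by rewrite /p; lra.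
have tr y : m <= y <= d -> tent alpha h m y = alpha * (d - y).
  move=> /andP[my yd]; rewrite /tent ger0_norm ?subr_ge0// max_r; last by rewrite /m; lra.
  by rewrite /m; lra.
(* The crossing point is [sup A]. The foot [p] of the tent is added by hand to make [A] nonempty, as
   the sign of [u p] is not given. *)
pose A := [set y | y = p \/ (p <= y <= m /\ tent alpha h m y <= u y)].
have pm : p <= m by rewrite /p; lra.
have supA : has_sup A.
  split; first by exists p; left.
  by exists m => y [->//|[/andP[_ //]]].
have Ap : p <= sup A by apply: ub_le_sup; [case: supA|left].
have Am : sup A <= m.
  by apply: sup_le_ub; [case: supA|move=> y [->//|[/andP[_ //]]]].
exists (sup A) => y /andP[cy yd] uy.
have [yp|py] := ltP y p.
  rewrite tent_out; last by rewrite ler0_norm; move: yp; rewrite /p; lra.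
  by rewrite mulr_le0//; lra.
have [ym|my] := ltP m y.
  apply: mulr_ge0; first lra.
  rewrite tr; last by apply/andP; split; lra.
  (* Since [u d = 0], the Lipschitz bound gives [u y <= alpha * (d - y)], the value of the tent. *)
  have := lip y d cy yd (lexx d); rewrite ud subr0 ger0_norm//; lra.
have [yz|zy] := ltP y (sup A).
  rewrite mulr_le0//; first lra.
  (* Some [y'] of [A] lies beyond [y]. From [y'] back to [y] the tent loses exactly
     [alpha * (y' - y)] and [u] at most that, so the tent is still below [u] at [y]. *)
  have [y' [->|[/andP[py' ym'] tu]] yy'] := sup_gt supA.1 yz; first by lra.
  have := lip y y' cy (ltW yy') (_ : y' <= d).
  rewrite ler_norml => /(_ _)/andP[]; first by rewrite /m in ym'; lra.
  move: tu; rewrite !tl ?py ?my ?py' ?ym'//; lra.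
have [->|yA] := eqVneq y (sup A); first by rewrite subrr mul0r.
rewrite mulr_ge0//; first lra.
(* If the tent were below [u] at [y], then [y] would belong to [A] and could not exceed [sup A]. *)
rewrite subr_ge0 leNgt; apply/negP => tu.
have : y <= sup A.
  by apply: ub_le_sup; [case: supA|right; rewrite py my; split=> //; exact: ltW].
by move=> ?; move/eqP: yA; apply; lra.
Qed.

(** The reflection [t -> -t] exchanges the two endpoints and carries this to the right-hand case;
    the crossing point changes sign. *)
Lemma tent_left_crossing {R : realType} (c d alpha h : R) (u : R -> R) :
  0 <= alpha -> 0 <= h -> c + h + h <= d -> u c = 0 ->
  (forall x y, c <= x -> x <= y -> y <= d -> `|u x - u y| <= alpha * (y - x)) ->
  exists z, forall y, c <= y <= d -> 0 <= u y ->
    0 <= (y - z) * (u y - tent alpha h (c + h) y).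
Proof.
move=> a0 h0 cd uc lip.
have [||x y dx xy yc|z zP] :=
  @tent_right_crossing _ (- d) (- c) _ h (fun t => u (- t)) a0 h0.
- lra.
- by rewrite opprK.
- rewrite distrC (_ : y - x = - x - - y); last lra.
  by apply: lip; lra.
exists (- z) => y /andP[cy yd] uy.
have := zP (- y); rewrite opprK => /(_ _ uy).
rewrite {1}/tent (_ : - y - (- c - h) = - (y - (c + h))); last lra.
by rewrite normrN -/(tent alpha h (c + h) y) => zy; have := zy; lra.
Qed.

(** * Extremality among all admissible densities *)

Lemma densities_mass {R : realType} (c d alpha : R) (u : R -> R) :
  densities c d alpha u -> \int[@lebesgue_measure R]_(x in `[c, d]) u x = 1.
Proof. by case=> [[_ cu _ _] u0 + _]; rewrite L1_normE// => -[]. Qed.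

Lemma densities_lipschitz {R : realType} (c d alpha : R) (u : R -> R) :
  densities c d alpha u ->
  forall x y, c <= x -> x <= y -> y <= d -> `|u x - u y| <= alpha * (y - x).
Proof. by case=> [[_ cu _ _] _ _ [v wd va]]; exact: weak_derivative_lipschitz va. Qed.

Lemma tent_right_maximizer {R : realType} (c d alpha h : R) :
  0 <= alpha -> 0 <= h -> alpha * h ^+ 2 = 1 -> c <= d - h - h ->
  global_maximizer (densities c d alpha) (expectation_density c d)
    (tent alpha h (d - h)).
Proof.
move=> a0 h0 ah cd.
have tD : densities c d alpha (tent alpha h (d - h)).
  by apply: densities_tent => //; lra.
split=> // u uD; have lip := densities_lipschitz uD.
have [[_ cu _ ud] u0 _ _] := uD.
have [z zP] := tent_right_crossing a0 h0 cd ud lip.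
apply: (@le_expectation_density _ _ _ z) => //.
- exact/continuous_subspaceT/continuous_tent.
- by rewrite (densities_mass tD) (densities_mass uD).
(* Nonnegativity of [u] holds almost everywhere, so the crossing inequality is transferred pointwise
   on that set. *)
- move: u0; apply: filterS; first exact: (ae_filter_ringOfSetsType lebesgue_measure).
  by move=> y u0 ycd; apply: zP (u0 ycd); rewrite in_itv in ycd.
Qed.

Lemma tent_left_minimizer {R : realType} (c d alpha h : R) :
  0 <= alpha -> 0 <= h -> alpha * h ^+ 2 = 1 -> c + h + h <= d ->
  global_minimizer (densities c d alpha) (expectation_density c d)
    (tent alpha h (c + h)).
Proof.
move=> a0 h0 ah cd.
have tD : densities c d alpha (tent alpha h (c + h)).
  by apply: densities_tent => //; lra.
split=> // u uD; have lip := densities_lipschitz uD.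
have [[_ cu uc _] u0 _ _] := uD.
have [z zP] := tent_left_crossing a0 h0 cd uc lip.
apply: (@le_expectation_density _ _ _ z) => //.
- exact/continuous_subspaceT/continuous_tent.
- by rewrite (densities_mass tD) (densities_mass uD).
- move: u0; apply: filterS; first exact: (ae_filter_ringOfSetsType lebesgue_measure).
  by move=> y u0 ycd; apply: zP (u0 ycd); rewrite in_itv in ycd.
Qed.

Unset Implicit Arguments.

Theorem theorem1p2 (R : realType) (c d : R) (hcd : c < d)
  (hcase : 0 <= c \/ d <= 0) :
  exists alpha0 a0 : R,
    [/\ Num.max (c ^+ 2) (d ^+ 2) / 2 <= alpha0, 0 < alpha0, 0 < a0 &
    forall alpha : R, alpha0 <= alpha ->
    forall a b : R, a < b ->
      (0 <= c -> d < a -> a0 <= a ->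
        (forall eps : R, 0 < eps -> 1 < K_I c d alpha eps) ->
        exists fm : R -> R, global_maximizer (densities c d alpha)
          (expectation_density c d) fm) /\
      (d <= 0 -> b < c -> b <= - a0 ->
        (forall eps : R, 0 < eps -> 1 < K_II c d alpha eps) ->
        exists fm : R -> R, global_minimizer (densities c d alpha)
          (expectation_density c d) fm)].
Proof.
(* The second term of the maximum ensures that a tent of slope [alpha] and mass 1 fits into
   [[c, d]]. *)
exists (Num.max (Num.max (c ^+ 2) (d ^+ 2) / 2) (4 / (d - c) ^+ 2)), 1.
have dc0 : 0 < d - c by rewrite subr_gt0.
have a0 : 0 < 4 / (d - c) ^+ 2 by rewrite divr_gt0// exprn_gt0.
split=> //; first by rewrite le_max lexx.
  by rewrite lt_max a0 orbT.
move=> alpha; rewrite ge_max => /andP[_ alphaP] a b ab.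
have alpha0 : 0 < alpha by exact: lt_le_trans alphaP.
(* The half-width that solves [alpha * h^2 = 1]. *)
pose h := (Num.sqrt alpha)^-1.
have h0 : 0 <= h by rewrite invr_ge0 sqrtr_ge0.
have ah : alpha * h ^+ 2 = 1.
  by rewrite exprVn sqr_sqrtr ?ltW// divff// gt_eqF.
have h2 : 2 * h <= d - c.
  (* Squaring and multiplying by [alpha] turns the claim into [4 <= alpha * (d - c)^2]. *)
  rewrite -(@ler_pXn2r _ 2)// ?nnegrE ?mulr_ge0// ?(ltW dc0)//.
  rewrite -(ler_pM2l alpha0) exprMn mulrCA ah mulr1.
  by rewrite -ler_pdivrMr ?exprn_gt0//; lra.
split=> _ _ _ _.
  exists (tent alpha h (d - h)); apply: tent_right_maximizer => //; lra.
exists (tent alpha h (c + h)); apply: tent_left_minimizer => //; lra.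
Qed.
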